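(* For a positive integer $\Delta$, every graph $G$ with $n$ vertices and with maximum degree $\Delta$ satisfies $$\min\overline{R}(G)\leq O\!\left(n^{(\Delta+1)\lceil\log(\Delta+1)\rceil+1}\right),$$ where $\Delta$ is regarded as a constant (the implied constant may depend on $\Delta$ but not on $n$ or $G$).
   Context: All logarithms are base 2. An ordered graph is a pair $\mathcal{G}=(G,\prec)$ where $G$ is a (simple) graph and $\prec$ is a total ordering of its vertices; $\mathcal{G}$ is called an ordering of $G$. Two ordered graphs are isomorphic if there is a graph isomorphism between them preserving the vertex orderings. $\mathcal{K}_N$ denotes the (unique up to isomorphism) ordered complete graph on $N$ vertices. $\mathcal{G}=(G,\prec_1)$ is an ordered subgraph of $\mathcal{H}=(H,\prec_2)$ if $G$ is a subgraph of $H$ and $\prec_1$ is a suborder of $\prec_2$. The ordered Ramsey number $\overline{R}(\mathcal{G})$ is the minimum integer $N$ such that every $2$-coloring of the edges of $\mathcal{K}_N$ contains a monochromatic ordered subgraph isomorphic to $\mathcal{G}$. For a graph $G$, $\min\overline{R}(G):=\min\{\overline{R}(\mathcal{G}) : \mathcal{G}\text{ is an ordering of }G\}$. *)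

(* Defs.v *)
From HB Require Import structures.
From mathcomp Require Import all_boot.

Set Implicit Arguments.
Unset Strict Implicit.
Unset Printing Implicit Defensive.

Record sgraph (V : finType) := SGraph {
  adj :> rel V;
  adj_sym : symmetric adj;
  adj_irr : irreflexive adj }.

Definition max_degree (V : finType) (G : sgraph V) : nat :=
  \max_(x : V) #|[set y | G x y]|.

Definition strict_total (V : finType) (r : rel V) : bool :=
  [&& [forall x, ~~ r x x],
      [forall x, forall y, forall z, r x y && r y z ==> r x z]
    & [forall x, forall y, (x != y) ==> r x y || r y x]].

(* The relation is stored as a finite function so that the orderings of [V]
   form a finite type, over which [min_ordered_ramsey] can minimize. *)
Record ordering (V : finType) := Ordering {
  ordering_fun : {ffun V -> {ffun V -> bool}};
  ordering_total : strict_total (fun x y => ordering_fun x y) }.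

HB.instance Definition _ (V : finType) :=
  [isSub for @ordering_fun V].
HB.instance Definition _ (V : finType) := [Finite of ordering V by <:].

Definition prec (V : finType) (o : ordering V) : rel V :=
  fun x y => ordering_fun o x y.

Lemma prec_irr (V : finType) (o : ordering V) : irreflexive (prec o).
Proof.
move=> x; have /and3P[/forallP irr _ _] := ordering_total o.
exact: negbTE (irr x).
Qed.

Lemma prec_trans (V : finType) (o : ordering V) : transitive (prec o).
Proof.
move=> y x z xy yz; have /and3P[_ /forallP tr _] := ordering_total o.
have /forallP/(_ y)/forallP/(_ z)/implyP := tr x; apply.
by apply/andP; split.
Qed.

Lemma prec_total (V : finType) (o : ordering V) (x y : V) :
  x != y -> prec o x y || prec o y x.
Proof.
move=> xy; have /and3P[_ _ /forallP tot] := ordering_total o.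
by have /forallP/(_ y)/implyP := tot x; apply.
Qed.

Fact pullback_total (V : finType) (h : V -> nat) (h_inj : injective h) :
  strict_total (fun x y => [ffun x => [ffun y => h x < h y]] x y).
Proof.
apply/and3P; split.
- by apply/forallP=> x; rewrite !ffunE ltnn.
- apply/forallP=> x; apply/forallP=> y; apply/forallP=> z; rewrite !ffunE.
  by apply/implyP=> /andP[]; apply: ltn_trans.
- apply/forallP=> x; apply/forallP=> y; rewrite !ffunE -neq_ltn.
  by apply/implyP; apply: contra_neq => /h_inj.
Qed.

Definition pullback_ordering (V : finType) (h : V -> nat)
    (h_inj : injective h) : ordering V :=
  Ordering (pullback_total h_inj).

Definition natural_ordering (N : nat) : ordering 'I_N :=
  pullback_ordering (@ord_inj N).

Lemma natural_orderingE (N : nat) (i j : 'I_N) :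
  prec (natural_ordering N) i j = (i < j).
Proof. by rewrite /prec /= !ffunE. Qed.

(* An arbitrary ordering, only used to witness that orderings exist. *)
Definition enum_ordering (V : finType) : ordering V :=
  pullback_ordering (inj_comp (@ord_inj _) (@enum_rank_inj V)).

Record ograph (V : finType) := OGraph {
  ograph_graph : sgraph V;
  ograph_order : ordering V }.

(* [H] contains an ordered subgraph isomorphic to [G] iff such an [f] exists,
   the subgraph being the image of [G]. *)
Definition ordered_embedding (V W : finType) (G : ograph V) (H : ograph W)
    (f : {ffun V -> W}) : bool :=
  [&& injectiveb f,
      [forall x, forall y,
        ograph_graph G x y ==> ograph_graph H (f x) (f y)]
    & [forall x, forall y,
        prec (ograph_order G) x y ==> prec (ograph_order H) (f x) (f y)]].

(* A 2-coloring of the edges of the complete graph on ['I_N]; an edge is a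
   two-element set, and the values on other sets are never looked at. *)
Definition coloring (N : nat) := {ffun {set 'I_N} -> bool}.

Section ColorClass.

Variables (N : nat) (c : coloring N) (b : bool).

Definition color_adj : rel 'I_N :=
  fun i j => (i != j) && (c [set i; j] == b).

Fact color_adj_sym : symmetric color_adj.
Proof. by move=> i j; rewrite /color_adj eq_sym setUC. Qed.

Fact color_adj_irr : irreflexive color_adj.
Proof. by move=> i; rewrite /color_adj eqxx. Qed.

Definition color_class : ograph 'I_N :=
  OGraph (SGraph color_adj_sym color_adj_irr) (natural_ordering N).

End ColorClass.

Definition arrows (V : finType) (N : nat) (G : ograph V) : bool :=
  [forall c : coloring N, exists b : bool, exists f : {ffun V -> 'I_N},
    ordered_embedding G (color_class c b) f].

(* Ramsey's theorem, needed for the ordered Ramsey number to be well defined. *)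
Lemma ramsey_seq (s t : nat) :
  exists N, forall (T : eqType) (c : rel T) (l : seq T), N <= size l ->
    exists2 l', subseq l' l &
      (pairwise c l' /\ size l' = s) \/
      (pairwise (fun x y => ~~ c x y) l' /\ size l' = t).
Proof.
have [m] := ubnP (s + t); elim: m s t => // m IHm [|s] [|t] lt_st.
- by exists 0 => T c l _; exists [::]; [exact: sub0seq | left].
- by exists 0 => T c l _; exists [::]; [exact: sub0seq | left].
- by exists 0 => T c l _; exists [::]; [exact: sub0seq | right].
have [|N1 H1] := IHm s t.+1; first by rewrite addSn in lt_st.
have [|N2 H2] := IHm s.+1 t; first by rewrite addnS in lt_st.
exists (N1 + N2).+1 => T c -[//|x l] /=; rewrite ltnS => le_l.
have : (N1 <= size (filter (c x) l)) || (N2 <= size (filter (predC (c x)) l)).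
  rewrite !size_filter; case: leqP => //= lt1; rewrite -(leq_add2l N1).
  by apply: leq_trans le_l _; rewrite -(count_predC (c x)) leq_add2r ltnW.
case/orP=> [/(H1 _ c) | /(H2 _ c)] [l' sub_l' Hl'].
- have sub_l : subseq l' l by apply: subseq_trans sub_l' (filter_subseq _ _).
  case: Hl' => [[pw sz]|[pw sz]].
  + exists (x :: l'); first by rewrite /= eqxx.
    left; rewrite /= pw sz andbT; split=> //; apply/allP=> y.
    by move/(mem_subseq sub_l'); rewrite mem_filter => /andP[].
  + by exists l'; [apply: subseq_trans sub_l (subseq_cons _ _) | right].
- have sub_l : subseq l' l by apply: subseq_trans sub_l' (filter_subseq _ _).
  case: Hl' => [[pw sz]|[pw sz]].
  + by exists l'; [apply: subseq_trans sub_l (subseq_cons _ _) | left].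
  + exists (x :: l'); first by rewrite /= eqxx.
    right; rewrite /= pw sz andbT; split=> //; apply/allP=> y.
    by move/(mem_subseq sub_l'); rewrite mem_filter => /andP[].
Qed.

Definition prec_rank (V : finType) (o : ordering V) (x : V) : nat :=
  #|[set y | prec o y x]|.

Lemma prec_rank_ltn (V : finType) (o : ordering V) (x : V) :
  prec_rank o x < #|V|.
Proof.
rewrite -cardsT; apply/proper_card/properP.
by split; [exact: subsetT | exists x; rewrite ?inE ?prec_irr].
Qed.

Lemma prec_rank_homo (V : finType) (o : ordering V) (x y : V) :
  prec o x y -> prec_rank o x < prec_rank o y.
Proof.
move=> xy; apply/proper_card/properP; split; last first.
  by exists x; rewrite !inE ?prec_irr.
by apply/subsetP=> z; rewrite !inE => zx; apply: prec_trans xy.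
Qed.

Lemma ordered_ramsey_ex (V : finType) (G : ograph V) :
  exists N, arrows N G.
Proof.
have sorted_copy N (c : coloring N.+1) (b : bool) (l : seq 'I_N.+1) :
    size l = #|V| -> pairwise (fun i j : 'I_N.+1 => i < j) l ->
    pairwise (fun i j => c [set i; j] == b) l ->
    [exists f : {ffun V -> 'I_N.+1}, ordered_embedding G (color_class c b) f].
  move=> sz_l /(pairwiseP ord0) lt_l /(pairwiseP ord0) c_l.
  pose o := ograph_order G.
  pose f := [ffun x => nth ord0 l (prec_rank o x)].
  have f_homo x y : prec o x y -> f x < f y.
    move=> xy; rewrite !ffunE; apply: lt_l; rewrite ?inE ?sz_l ?prec_rank_ltn //.
    exact: prec_rank_homo.
  have f_col x y : prec o x y -> c [set f x; f y] == b.
    move=> xy; rewrite !ffunE; apply: c_l; rewrite ?inE ?sz_l ?prec_rank_ltn //.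
    exact: prec_rank_homo.
  have f_neq x y : x != y -> f x != f y.
    case/(prec_total o)/orP => /f_homo; first by move/ltn_eqF/negbT.
    by move/ltn_eqF/negbT; rewrite eq_sym.
  apply/existsP; exists f; apply/and3P; split.
  - by apply/injectiveP=> x y /eqP; apply: contraTeq => /f_neq.
  - apply/forallP=> x; apply/forallP=> y; apply/implyP=> Gxy.
    have xy : x != y.
      by apply: contraTneq Gxy => ->; rewrite (adj_irr (ograph_graph G)).
    rewrite /= /color_adj f_neq //=.
    by case/(prec_total o)/orP: xy => /f_col //; rewrite setUC.
  - apply/forallP=> x; apply/forallP=> y; apply/implyP=> xy.
    by rewrite natural_orderingE f_homo.
have [N HN] := ramsey_seq #|V| #|V|; exists N.+1; apply/forallP=> c.
have [|l sub_l Hl] := HN 'I_N.+1 (fun i j => c [set i; j]) (enum 'I_N.+1).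
  by rewrite size_enum_ord.
have lt_l : pairwise (fun i j : 'I_N.+1 => i < j) l.
  apply: (subseq_pairwise sub_l); rewrite -(pairwise_map val ltn) val_enum_ord.
  by rewrite -sorted_pairwise ?iota_ltn_sorted //; apply: ltn_trans.
apply/existsP; case: Hl => -[c_l sz_l]; [exists true | exists false].
- apply: sorted_copy (sz_l) lt_l _.
  by apply: sub_pairwise c_l => i j /= ->.
- apply: sorted_copy (sz_l) lt_l _.
  by apply: sub_pairwise c_l => i j /= /negbTE->.
Qed.

Definition ordered_ramsey (V : finType) (G : ograph V) : nat :=
  ex_minn (ordered_ramsey_ex G).

Definition min_ordered_ramsey (V : finType) (G : sgraph V) : nat :=
  ordered_ramsey (OGraph G
    [arg min_(o < enum_ordering V) ordered_ramsey (OGraph G o)]).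

Lemma min_ordered_ramsey_le (V : finType) (G : sgraph V) (o : ordering V) :
  min_ordered_ramsey G <= ordered_ramsey (OGraph G o).
Proof. by rewrite /min_ordered_ramsey; case: arg_minnP => // o' _; apply. Qed.

(* Main.v *)
(** Order the vertices by a proper colouring with [Delta + 1 <= 2 ^ k] colours,
    so that colour classes are intervals.  Cut a set of positions into [n]
    consecutive blocks and embed the vertices greedily in red, one per block.
    A vertex has at most [Delta] neighbours, so if this fails there are sets
    [X < Y], smaller only by a factor [O(n * q ^ Delta)], such that every point
    of [X] has at most [#|Y| / q] red neighbours in [Y].  Recursing inside [X],
    then discarding the points of [Y] with too many red neighbours in one of
    the sets obtained and recursing in the rest of [Y], gives after [k] steps
    sets [A_1 < ... < A_(2 ^ k)] in which a point of [A_j] has few red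
    neighbours in each earlier [A_i].  Embedding the last vertex first, with the
    [i]-th colour class in [A_i], then succeeds in blue.  Taking [q = O(n)] loses
    a factor [O(n ^ (Delta + 1))] per step, and the last embedding needs sets
    of size [n]. *)
Require Import Defs.
From mathcomp Require Import all_boot.
From mathcomp Require Import zify.

Set Implicit Arguments.
Unset Strict Implicit.
Unset Printing Implicit Defensive.

(** * Union bound and consecutive blocks *)

(** Union bound: at most [D] sets, each holding at most [1 / (D + 1)] of [C] in size, cannot cover
    it. *)
Lemma avoid_family (I T : finType) (U : {set I}) (B : I -> {set T})
    (C : {set T}) (D : nat) :
  #|U| <= D -> 0 < #|C| -> (forall u, u \in U -> D.+1 * #|B u| <= #|C|) ->
  exists2 x, x \in C & forall u, u \in U -> x \notin B u.
Proof.
move=> leU C_gt0 leB.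
have lt_bad : #|\bigcup_(u in U) B u| < #|C|.
  rewrite -(ltn_pmul2l (ltn0Sn D)); apply: (@leq_ltn_trans (D * #|C|)).
    apply: (@leq_trans (\sum_(u in U) #|C|)); last first.
      by rewrite sum_nat_const leq_mul2r leU orbT.
    apply: (@leq_trans (\sum_(u in U) D.+1 * #|B u|)); last exact: leq_sum.
    rewrite -big_distrr leq_mul2l /=.
    elim/big_rec2: _ => [|u k A _ le_k]; first by rewrite cards0.
    by rewrite (leq_trans (leq_card_setU _ _)) // leq_add2l.
  by rewrite ltn_mul2r C_gt0 ltnSn.
have /subsetPn[x xC x_bad] : ~~ (C \subset \bigcup_(u in U) B u).
  by apply: contraL lt_bad => /subset_leq_card; rewrite -leqNgt.
by exists x => // u uU; apply: contra x_bad => xB; apply/bigcupP; exists u.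
Qed.

(** [W i] is the [i]-th run of [m] entries in the increasing enumeration of [S]; from index [n] on,
    runs may be short or empty. *)
Lemma consecutive_blocks (N n m : nat) (S : {set 'I_N}) :
  n * m <= #|S| ->
  exists W : nat -> {set 'I_N},
    [/\ forall i, W i \subset S, forall i, i < n -> #|W i| = m
      & forall i j x y, i < j -> x \in W i -> y \in W j -> x < y].
Proof.
move=> le_S.
pose s := enum S.
have lt_s : pairwise (fun i j : 'I_N => i < j) s.
  have sub_s : subseq s (enum 'I_N) by rewrite /s enumT filter_subseq.
  apply: (subseq_pairwise sub_s); rewrite -(pairwise_map val ltn) val_enum_ord.
  by rewrite -sorted_pairwise ?iota_ltn_sorted //; apply: ltn_trans.
exists (fun i => [set x in take m (drop (i * m) s)]); split.
- move=> i; apply/subsetP=> x; rewrite inE => /mem_take/mem_drop.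
  by rewrite mem_enum.
- move=> i lt_i; rewrite cardsE; have /card_uniqP-> : uniq (take m (drop (i * m) s)).
    by rewrite take_uniq // drop_uniq // enum_uniq.
  rewrite size_take size_drop -cardE; have : i.+1 * m <= n * m by rewrite leq_mul2r lt_i orbT.
  by rewrite mulSn; case: ifP; lia.
- move=> i j x y lt_ij; rewrite !inE take_drop => /mem_drop x_in /mem_take y_in.
  have : pairwise (fun i j : 'I_N => i < j) (take (j * m) s ++ drop (j * m) s).
    by rewrite cat_take_drop.
  rewrite pairwise_cat => /andP[/allrelP lt_xy _]; apply: lt_xy => //.
  have le_ij : m + i * m <= j * m by rewrite -mulSn leq_mul2r lt_ij orbT.
  by move: x_in; rewrite -(minn_idPl le_ij) take_min; apply: mem_take.
Qed.

(** * Greedy embedding, vertex by vertex *)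

Section Embedding.

Variables (T V : finType) (r : rel T) (G : sgraph V) (h : V -> nat) (D : nat).
Hypothesis r_sym : symmetric r.
Hypothesis h_inj : injective h.
Hypothesis leD : forall v, #|[set u | G v u]| <= D.

(** Vertices are placed in increasing [h]: at most [D] neighbours of [v] are already placed, and
    each forbids at most [1 / (D + 1)] of [W v]. *)
Lemma embed_avoiding (W : V -> {set T}) :
  (forall v, 0 < #|W v|) ->
  (forall u v y, G u v -> h u < h v -> y \in W u ->
     D.+1 * #|[set x in W v | r y x]| <= #|W v|) ->
  exists f : V -> T,
    (forall v, f v \in W v) /\ forall u v, G u v -> ~~ r (f u) (f v).
Proof.
move=> W_gt0 leW.
(* [f] stays total; only edges among vertices of rank below [t] are controlled. *)
suff /(_ (\max_v h v).+1)[f [fW fr]] : forall t, exists f : V -> T,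
    (forall v, f v \in W v) /\
    forall u v, h u < t -> h v < t -> G u v -> ~~ r (f u) (f v).
  by exists f; split=> // u v; apply: fr; rewrite ltnS (leq_bigmax (F := h)).
elim=> [|t [f [fW fr]]].
  have /fin_all_exists[f fW] : forall v, exists x, x \in W v.
    by move=> v; apply/card_gt0P.
  by exists f; split.
case: (pickP (fun v => h v == t)) => [v0 /eqP hv0 | no_t]; last first.
  have lt_t u : (h u < t.+1) = (h u < t) by rewrite ltnS leq_eqVlt no_t.
  by exists f; split=> // u v; rewrite !lt_t; apply: fr.
pose U := [set u | G v0 u & h u < t].
have [||u|x xW xU] := @avoid_family V T U
    (fun u => [set x in W v0 | r (f u) x]) (W v0) D.
- apply: leq_trans (leD v0); apply/subset_leq_card/subsetP=> u.
  by rewrite !inE => /andP[].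
- exact: W_gt0.
- by rewrite inE adj_sym => /andP[Gu hu]; apply: leW (fW u); rewrite ?hv0.
exists (fun u => if u == v0 then x else f u); split.
  by move=> v; case: eqP => [->|].
have lt_t u : u != v0 -> h u < t.+1 -> h u < t.
  by rewrite ltnS -hv0 => /(contra_neq (@h_inj _ _)) ne; rewrite ltn_neqAle ne.
have avoid u : h u < t -> G v0 u -> ~~ r (f u) x.
  by move=> hu Gu; have := xU u; rewrite !inE Gu hu xW; apply.
move=> u v; case: (eqVneq u v0) (lt_t u) => [-> _|_ /(_ isT) hut];
  case: (eqVneq v v0) (lt_t v) => [-> _|_ /(_ isT) hvt].
- by rewrite adj_irr.
- by move=> _ /hvt hv Gv; rewrite r_sym avoid.
- by move=> /hut hu _ Gu; rewrite avoid // adj_sym.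
- by move=> /hut hu /hvt hv; apply: fr.
Qed.

(** Each vertex goes to a point that shrinks no later neighbour's places more than [q]-fold. If none
    exists, some later neighbour [u] is spoiled by at least [1 / (D + 1)] of the candidates; these
    and the places of [u] form the sparse pair. The factor [q ^ D] accounts for earlier
    shrinking. *)
Lemma embed_or_sparse_pair (W : V -> {set T}) (m q : nat) :
  0 < m -> 0 < q -> (forall v, m <= #|W v|) ->
  (exists f : V -> T,
     (forall v, f v \in W v) /\ forall u v, G u v -> r (f u) (f v)) \/
  exists u v (X Y : {set T}),
    [/\ h u < h v, X \subset W u & Y \subset W v] /\
    [/\ m <= D.+1 * q ^ D * #|X|, m <= D.+1 * q ^ D * #|Y|
      & forall x, x \in X -> q * #|[set y in Y | r x y]| <= #|Y|].
Proof.
move=> m_gt0 q_gt0 leW; set sparse := (X in _ \/ X).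
pose nb t v := [set u | G v u & h u < t].
pose cand t (f : V -> T) v :=
  [set y in W v | [forall u in nb t v, r (f u) y]].
have le_nb t v : #|nb t v| <= D.
  apply: leq_trans (leD v); apply/subset_leq_card/subsetP=> u.
  by rewrite !inE => /andP[].
(* [cand t f v] holds the places still allowed for [v] once the vertices of rank
   below [t] are embedded; each embedded neighbour shrinks it at most [q]-fold. *)
suff /(_ (\max_v h v).+1)[[f [fW fr _]]|] : forall t, (exists f : V -> T,
    [/\ forall v, f v \in W v,
       forall u v, h u < t -> h v < t -> G u v -> r (f u) (f v)
     & forall v, t <= h v -> m <= q ^ #|nb t v| * #|cand t f v|]) \/ sparse.
- left; exists f; split=> // u v; apply: fr; rewrite ltnS; exact: (leq_bigmax (F := h)).
- by right.
elim=> [|t [[f [fW fr fC]]|]]; last by right.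
- left; have /fin_all_exists[f fW] : forall v, exists x, x \in W v.
    by move=> v; apply/card_gt0P; apply: leq_trans (leW v).
  exists f; split=> // v _.
  have -> : nb 0 v = set0 by apply/setP=> u; rewrite !inE ltn0 andbF.
  have -> : cand 0 f v = W v.
    apply/setP=> y; rewrite !inE andb_idr // => _.
    by apply/forall_inP=> u; rewrite inE ltn0 andbF.
  by rewrite cards0 mul1n.
case: (pickP (fun v => h v == t)) => [v0 /eqP hv0 | no_t]; last first.
  have lt_t u : (h u < t.+1) = (h u < t) by rewrite ltnS leq_eqVlt no_t.
  have nbE v : nb t.+1 v = nb t v by apply/setP=> u; rewrite !inE lt_t.
  left; exists f; split=> // [u v|v /ltnW hv]; first by rewrite !lt_t; apply: fr.
  by rewrite /cand nbE fC.
have cand_le t' v c : m <= q ^ #|nb t' v| * c -> m <= q ^ D * c.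
  by move=> /leq_trans; apply; rewrite leq_mul2r leq_pexp2l ?orbT.
pose C := cand t f v0.
pose B u := [set x in C | q * #|[set y in cand t f u | r x y]| < #|cand t f u|].
case: (boolP [exists u, [&& G v0 u, t < h u & #|C| <= D.+1 * #|B u|]]).
  case/existsP=> u /and3P[Gu hu le_C]; right.
  exists v0, u, (B u), (cand t f u); split; split.
  - by rewrite hv0.
  - by apply/subsetP=> x; rewrite !inE => /andP[/andP[]].
  - by apply/subsetP=> x; rewrite !inE => /andP[].
  - rewrite -mulnA mulnCA; apply: leq_trans (cand_le _ _ _ (fC v0 _)) _.
      by rewrite hv0.
    by rewrite leq_mul2l le_C orbT.
  - rewrite -mulnA; apply: leq_trans (cand_le _ _ _ (fC u (ltnW hu))) _.
    exact: leq_pmull.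
  - by move=> x; rewrite inE => /andP[_ /ltnW].
move=> /existsPn no_u; left.
have [||u|x xC xU] := @avoid_family V T [set u | G v0 u & t < h u] B C D.
- apply: leq_trans (leD v0); apply/subset_leq_card/subsetP=> u.
  by rewrite !inE => /andP[].
- have := fC v0; rewrite hv0 => /(_ (leqnn t)) /(leq_trans m_gt0).
  by rewrite muln_gt0 => /andP[].
- rewrite inE => /andP[Gu hu]; have := no_u u.
  by rewrite Gu hu -ltnNge => /ltnW.
have lt_t u : u != v0 -> h u < t.+1 -> h u < t.
  by rewrite ltnS -hv0 => /(contra_neq (@h_inj _ _)) ne; rewrite ltn_neqAle ne.
have [xW /forall_inP xr] : x \in W v0 /\ [forall u in nb t v0, r (f u) x].
  by move: xC; rewrite inE => /andP.
exists (fun u => if u == v0 then x else f u); split.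
- by move=> v; case: eqP => [->|].
- move=> u v; case: (eqVneq u v0) (lt_t u) => [-> _|_ /(_ isT) hut];
    case: (eqVneq v v0) (lt_t v) => [-> _|_ /(_ isT) hvt].
  + by rewrite adj_irr.
  + by move=> _ /hvt hv Gv; rewrite r_sym xr // inE Gv.
  + by move=> /hut hu _ Gu; rewrite xr // inE adj_sym Gu.
  + by move=> /hut hu /hvt hv; apply: fr.
move=> v hv; set f' := fun _ => _.
have nbS u : h u < t.+1 = (u == v0) || (h u < t).
  rewrite ltnS leq_eqVlt -hv0; congr (_ || _).
  by apply/eqP/eqP=> [/h_inj|->].
have candS : [set y in cand t f v | G v v0 ==> r x y] \subset cand t.+1 f' v.
  apply/subsetP=> y; rewrite !inE => /andP[/andP[-> /forall_inP yr] /implyP yx] /=.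
  apply/forall_inP=> u; rewrite inE nbS /f'; case: eqVneq => [-> /andP[/yx]//|_ Gu].
  by apply: yr; rewrite inE.
(* A neighbour of [v0] gains one placed neighbour, and the extra factor [q] pays for the shrinking;
   for any other [v] the bound carries over. *)
case: (boolP (G v v0)) candS => Gv candS.
  have nbE : #|nb t.+1 v| = #|nb t v|.+1.
    rewrite (_ : nb t.+1 v = v0 |: nb t v); first by rewrite cardsU1 !inE hv0 ltnn andbF.
    apply/setP=> u; rewrite !inE nbS.
    by case: eqVneq => [->|]; rewrite ?Gv.
  have /xU : v \in [set u | G v0 u & t < h u] by rewrite inE adj_sym Gv hv.
  rewrite in_set xC /= -leqNgt => le_v.
  apply: leq_trans (fC v (ltnW hv)) _; rewrite nbE expnSr -mulnA leq_mul2l.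
  rewrite (leq_trans le_v) ?orbT // leq_mul2l; apply/orP; right.
  by apply: leq_trans (subset_leq_card candS).
have -> : nb t.+1 v = nb t v.
  apply/setP=> u; rewrite !inE nbS.
  by case: eqVneq => [->|]; rewrite ?(negbTE Gv).
apply: leq_trans (fC v (ltnW hv)) _; rewrite leq_mul2l; apply/orP; right.
apply: leq_trans (subset_leq_card candS); apply/subset_leq_card/subsetP=> y.
by rewrite inE andbT.
Qed.

End Embedding.

(** * Double counting and one-sided sparsity *)

Lemma double_count_rel (T : finType) (r : rel T) (A B : {set T}) :
  symmetric r ->
  \sum_(y in B) #|[set x in A | r y x]| = \sum_(x in A) #|[set y in B | r x y]|.
Proof.
move=> r_sym.
have cardE (C : {set T}) z : #|[set x in C | r z x]| = \sum_(x in C) (r z x : nat).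
  rewrite -sum1_card big_mkcond [RHS]big_mkcond; apply: eq_bigr => x _.
  by rewrite inE; case: (x \in C); case: (r z x).
under eq_bigr do rewrite cardE; rewrite exchange_big /=.
by apply: eq_bigr => x _; rewrite cardE; apply: eq_bigr => y _; rewrite r_sym.
Qed.

(** Markov's inequality: at most [#|A| * #|B| / q] pairs are related, and each point counted takes
    more than [#|A| / L] of them. *)
Lemma card_high_degree (T : finType) (r : rel T) (A B : {set T}) (q L : nat) :
  symmetric r -> 0 < #|A| ->
  (forall x, x \in A -> q * #|[set y in B | r x y]| <= #|B|) ->
  q * #|[set y in B | #|A| < L * #|[set x in A | r y x]|]| <= L * #|B|.
Proof.
move=> r_sym A_gt0 le_q; rewrite -(leq_pmul2r A_gt0) -mulnA.
set bad := [set y in B | _].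
apply: (@leq_trans (q * (L * \sum_(y in B) #|[set x in A | r y x]|))).
  rewrite leq_mul2l; apply/orP; right; rewrite -sum_nat_const big_distrr /=.
  rewrite [X in _ <= X](big_setID bad) /= -[X in X <= _]addn0; apply: leq_add => //.
  rewrite (setIidPr _); last by apply/subsetP=> y; rewrite inE => /andP[].
  by apply: leq_sum => y; rewrite inE => /andP[_ /ltnW].
rewrite double_count_rel // mulnCA -mulnA leq_mul2l; apply/orP; right.
rewrite big_distrr mulnC -sum_nat_const; exact: leq_sum.
Qed.

(* The density condition is one-sided: only points of the later set [B] are
   required to have few neighbours.  It therefore passes to subsets of [B]. *)
Definition sparse_below (N : nat) (r : rel 'I_N) (L : nat) (A B : {set 'I_N}) :=
  [forall y in B, [forall x in A, x < y] &&
    (L * #|[set x in A | r y x]| <= #|A|)].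

Lemma sparse_belowP (N : nat) (r : rel 'I_N) (L : nat)
    (A B : {set 'I_N}) y :
  sparse_below r L A B -> y \in B ->
  (forall x, x \in A -> x < y) /\ L * #|[set x in A | r y x]| <= #|A|.
Proof. by move=> /forall_inP AB /AB /andP[/forall_inP]. Qed.

(** * Towers of sparse sets and the two-colour dichotomy *)

Section TwoColors.

Variables (N n D : nat) (r : rel 'I_N) (V : finType) (G : sgraph V).
Variable (h : V -> nat).
Hypothesis r_sym : symmetric r.
Hypothesis h_inj : injective h.
Hypothesis h_lt : forall v, h v < n.
Hypothesis leD : forall v, #|[set u | G v u]| <= D.
Hypothesis n_gt0 : 0 < n.

Definition monotone_copy (e : rel 'I_N) (f : V -> 'I_N) :=
  (forall u v, h u < h v -> f u < f v) /\ forall u v, G u v -> e (f u) (f v).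

(** Each doubling costs a factor [n] for the blocks, [D.+1 * q ^ D] for the sparse pair and [2] for
    the discard: each set found in [X] rules out at most [L / q] of [Y], so by the hypothesis on [q]
    at least half of [Y] survives. *)
Lemma sparse_tower (L q s j : nat) (S : {set 'I_N}) :
  ~ (exists f, monotone_copy r f) -> 0 < q -> 0 < s -> 2 ^ j * L <= q ->
  (n * (2 * (D.+1 * q ^ D))) ^ j * s <= #|S| ->
  exists l : seq {set 'I_N},
    [/\ size l = 2 ^ j, pairwise (sparse_below r L) l
      & forall A, A \in l -> A \subset S /\ s <= #|A|].
Proof.
move=> no_copy q_gt0 s_gt0; elim: j S => [|j IHj] S le_q.
  rewrite mul1n => le_S; exists [:: S]; split=> // A.
  by rewrite inE => /eqP->.
have le_qj : 2 ^ j * L <= q.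
  by apply: leq_trans le_q; rewrite leq_mul2r leq_exp2l // leqnSn orbT.
pose K := D.+1 * q ^ D.
have K_gt0 : 0 < K by rewrite muln_gt0 expn_gt0 q_gt0.
pose m := (n * (2 * K)) ^ j * s.
have m_gt0 : 0 < m by rewrite muln_gt0 s_gt0 expn_gt0 (muln_gt0 n) (muln_gt0 2) n_gt0 K_gt0.
rewrite expnS -/K -mulnA -/m -(mulnA n) -(mulnA 2) => /consecutive_blocks[W [WS cardW ltW]].
have [|v|[f [fW fr]]|[u [v [X [Y [[lt_uv XW YW] [leX leY XY]]]]]]] :=
    @embed_or_sparse_pair _ _ r G h D r_sym h_inj leD
      (fun v => W (h v)) (2 * (K * m)) q _ q_gt0.
- by rewrite (muln_gt0 2) (muln_gt0 K) K_gt0.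
- by rewrite cardW.
- by case: no_copy; exists f; split=> // u v lt_uv; apply: ltW lt_uv _ _.
move: leX leY; rewrite -/K mulnCA !leq_pmul2l // => leX leY.
have [|l1 [sz1 pw1 sub1]] := IHj X le_qj.
  by apply: leq_trans leX; apply: leq_pmull.
pose bad (A : {set 'I_N}) := [set y in Y | #|A| < L * #|[set x in A | r y x]|].
pose Y' := Y :\: \bigcup_(A <- l1) bad A.
have le_bad A : A \in l1 -> q * #|bad A| <= L * #|Y|.
  move=> /sub1[AX sA]; apply: card_high_degree => //.
    exact: leq_trans sA.
  by move=> x /(subsetP AX); apply: XY.
have leU : 2 * #|\bigcup_(A <- l1) bad A| <= #|Y|.
  rewrite -(leq_pmul2l q_gt0) mulnCA.
  apply: (@leq_trans (2 * (2 ^ j * (L * #|Y|)))); last first.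
    by rewrite !mulnA -expnS leq_mul2r le_q orbT.
  rewrite leq_mul2l /= -sz1 -sum1_size big_distrl /=.
  under [X in _ <= X]eq_bigr do rewrite mul1n.
  apply: (@leq_trans (\sum_(A <- l1) q * #|bad A|)); last first.
    by rewrite !big_seq; apply: leq_sum.
  rewrite -big_distrr leq_mul2l /=; apply/orP; right.
  elim/big_rec2: _ => [|A k B _ le_k]; first by rewrite cards0.
  by rewrite (leq_trans (leq_card_setU _ _)) // leq_add2l.
have [|l2 [sz2 pw2 sub2]] := IHj Y' le_qj.
  rewrite -/K -/m -(leq_pmul2l (isT : 0 < 2)).
  have half a b c d e : a + b = c -> a <= d -> 2 * e <= c -> 2 * d <= c ->
    2 * e <= 2 * b by lia.
  apply: half (cardsID (\bigcup_(A <- l1) bad A) Y) _ leY leU.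
  exact: subset_leq_card (subsetIr _ _).
exists (l1 ++ l2); split.
- by rewrite size_cat sz1 sz2 addnn -mul2n expnS.
(* Across the two halves, order comes from the blocks containing [X] and [Y], sparsity from [y]
   having survived the discard. *)
- rewrite pairwise_cat pw1 pw2 !andbT; apply/allrelP=> A B Al Bl.
  have [AX _] := sub1 A Al; have [BY _] := sub2 B Bl.
  apply/forall_inP=> y /(subsetP BY); rewrite inE => /andP[y_ok yY].
  apply/andP; split.
    apply/forall_inP=> x /(subsetP AX)/(subsetP XW) xW.
    exact: ltW lt_uv xW (subsetP YW y yY).
  rewrite leqNgt; apply: contra y_ok => y_bad.
  by rewrite (big_rem A) // inE inE yY y_bad.
- move=> A; rewrite mem_cat => /orP[/sub1[AX sA]|/sub2[AY sA]]; split=> //.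
    by apply: subset_trans AX (subset_trans XW (WS _)).
  apply: subset_trans AY (subset_trans (subsetDl _ _) (subset_trans YW (WS _))).
Qed.

Lemma monotone_copy_or_complement (k : nat) (col : V -> nat) :
  (forall v, col v < 2 ^ k) -> (forall u v, G u v -> col u != col v) ->
  (forall u v, h u < h v -> col u <= col v) ->
  (n * (2 * (D.+1 * (2 ^ k * (2 * n * D.+1)) ^ D))) ^ k * n <= N ->
  (exists f, monotone_copy r f) \/
  exists f, monotone_copy (fun x y => ~~ r x y) f.
Proof.
move=> lt_col col_proper col_mono leN.
(* Over finite functions the existence of a red copy is decidable, so the case split is
   constructive. *)
pose P (f : {ffun V -> 'I_N}) := [forall u, forall v,
  ((h u < h v) ==> (f u < f v)) && (G u v ==> r (f u) (f v))].
case: (boolP [exists f, P f]) => [/existsP[f /forallP Pf]|noP].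
  left; exists f; split=> u v;
    by have /forallP/(_ v)/andP[/implyP ? /implyP ?] := Pf u.
(* A block holds at least [1 / (2 * n)] of its set, so density [1 / L] in the set is at most
   [1 / (D + 1)] in the block. *)
right; pose L := 2 * n * D.+1.
have no_copy : ~ exists f, monotone_copy r f.
  case=> f [f_lt f_r]; case/existsP: noP; exists (finfun f).
  apply/forallP=> u; apply/forallP=> v; rewrite !ffunE.
  by apply/andP; split; apply/implyP; [apply: f_lt | apply: f_r].
have L_gt0 : 0 < L by rewrite !muln_gt0 n_gt0.
have [||l [sz_l pw_l sub_l]] :=
  @sparse_tower L (2 ^ k * L) n k setT no_copy _ n_gt0 (leqnn _).
- by rewrite muln_gt0 expn_gt0.
- by rewrite cardsT card_ord.
(* Vertices of one colour share a set; blocks indexed by [h] keep them in order. *)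
have /fin_all_exists[W HW] : forall A : {set 'I_N}, exists W : nat -> {set 'I_N},
    [/\ forall i, W i \subset A, forall i, i < n -> #|W i| = #|A| %/ n
      & forall i j x y, i < j -> x \in W i -> y \in W j -> x < y].
  by move=> A; apply: consecutive_blocks; rewrite mulnC leq_trunc_div.
pose A v := nth set0 l (col v).
have A_l v : A v \in l by rewrite mem_nth // sz_l.
have A_sparse u v : col u < col v -> sparse_below r L (A u) (A v).
  by move=> lt_uv; apply: (pairwiseP set0 pw_l); rewrite ?inE ?sz_l.
pose B v := W (A v) (h v).
have BA v : B v \subset A v by have [/(_ (h v))] := HW (A v).
have cardB v : #|B v| = #|A v| %/ n by have [_ /(_ (h v))->] := HW (A v).
have B_gt0 v : 0 < #|B v|.
  by rewrite cardB divn_gt0 //; have [] := sub_l _ (A_l v).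
(* Rounding costs at most a factor 2, since [B v] is nonempty. *)
have leA v : #|A v| <= 2 * n * #|B v|.
  rewrite {1}(divn_eq #|A v| n) -cardB; have := ltn_pmod #|A v| n_gt0.
  by have := B_gt0 v; nia.
(* The reversed rank makes the last vertices be embedded first. *)
have [u v|v|u v y Gu lt_uv yB|f [fB fr]] :=
    @embed_avoiding _ _ r G (fun v => n - h v) D r_sym _ leD B.
- by move=> e; apply: h_inj; have := h_lt u; have := h_lt v; lia.
- exact: B_gt0.
- have lt_h : h v < h u by lia.
  have lt_c : col v < col u.
    by rewrite ltn_neqAle col_mono // andbT eq_sym col_proper.
  have [_ le_A] :=
    sparse_belowP (A_sparse _ _ lt_c) (subsetP (BA u) y yB).
  have nn_gt0 : 0 < 2 * n by rewrite muln_gt0.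
  rewrite -(leq_pmul2l nn_gt0) mulnA; apply: leq_trans (leA v).
  apply: leq_trans le_A; rewrite leq_mul2l; apply/orP; right.
  apply/subset_leq_card/subsetP=> x; rewrite !inE.
  by move=> /andP[/(subsetP (BA v))-> ->].
exists f; split=> // u v lt_uv.
have := col_mono u v lt_uv; rewrite leq_eqVlt => /orP[/eqP eq_c|lt_c].
  have [_ _ ltW] := HW (A v); apply: ltW lt_uv _ (fB v).
  by have := fB u; rewrite /B /A eq_c.
have [lt_A _] :=
  sparse_belowP (A_sparse _ _ lt_c) (subsetP (BA v) _ (fB v)).
exact: lt_A _ (subsetP (BA u) _ (fB u)).
Qed.

End TwoColors.

(** * Proper colouring and the ordering it induces *)

(** Neighbours of a new vertex use at most [D] of the [D + 1] colours. *)
Lemma greedy_coloring (V : finType) (G : sgraph V) (D : nat) :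
  (forall v, #|[set u | G v u]| <= D) ->
  exists col : V -> nat,
    (forall v, col v <= D) /\ forall u v, G u v -> col u != col v.
Proof.
move=> leD.
suff [col [leC pC]] : exists col : V -> nat, (forall v, col v <= D) /\
    forall u v, u \in enum V -> v \in enum V -> G u v -> col u != col v.
  by exists col; split=> // u v; apply: pC; rewrite mem_enum.
elim: (enum V) => [|x s [col [leC pC]]]; first by exists (fun=> 0).
have /subsetPn[c _ c_free] :
    ~~ ([set: 'I_D.+1] \subset [set inord (col u) | u in [set u | G x u]]).
  apply: contraL (leD x) => /subset_leq_card; rewrite cardsT card_ord -ltnNge.
  by move=> /leq_trans; apply; apply: leq_imset_card.
have free u : G x u -> val c != col u.
  move=> Gu; apply: contra c_free => /eqP cu; apply/imsetP; exists u.
    by rewrite inE.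
  by apply: val_inj; rewrite /= inordK // ltnS leC.
exists (fun v => if v == x then val c else col v); split.
  by move=> v; case: eqP => // _; apply: ltn_ord c.
move=> u v; rewrite !inE; case: (eqVneq u x) => [->|_];
  case: (eqVneq v x) => [->|_] /=.
- by rewrite adj_irr.
- by move=> _ _; apply: free.
- by move=> _ _ Gu; rewrite eq_sym free // adj_sym.
- exact: pC.
Qed.

Lemma rank_by_color (V : finType) (col : V -> nat) :
  exists h : V -> nat,
    [/\ injective h, forall v, h v < #|V|
      & forall u v, h u < h v -> col u <= col v].
Proof.
pose le_col u v := col u <= col v.
have le_col_tr : transitive le_col by move=> v u w; apply: leq_trans.
have le_col_total : total le_col by move=> u v; apply: leq_total.
pose s := sort le_col (enum V).
have mem_s v : v \in s by rewrite mem_sort mem_enum.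
exists (index^~ s); split.
- by move=> u v /(congr1 (nth u s)); rewrite !nth_index.
- by move=> v; rewrite cardE -(size_sort le_col) index_mem.
- move=> u v; apply: (sorted_ltn_index le_col_tr (sort_sorted le_col_total _)).
    exact: mem_s.
  exact: mem_s.
Qed.

Theorem corollary3p4 (Delta : nat) (hDelta : 0 < Delta) :
  exists C : nat, forall (n : nat) (V : finType) (G : sgraph V),
    #|V| = n -> max_degree G = Delta ->
    min_ordered_ramsey G <= C * n ^ (Delta.+1 * up_log 2 Delta.+1 + 1).
Proof.
set k := up_log 2 Delta.+1.
(* The bound for one ordering is [k] equal factors, each containing [n * n ^ Delta], times a last
   [n]; [C] is what remains without powers of [n]. *)
exists ((2 * (Delta.+1 * (2 ^ k * (2 * Delta.+1)) ^ Delta)) ^ k) => n V G cardV degG.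
have leD v : #|[set u | G v u]| <= Delta.
  by rewrite -degG; apply: (leq_bigmax (F := fun x => #|[set y | G x y]|)).
have n_gt0 : 0 < n.
  rewrite -cardV lt0n; apply: contraTneq hDelta => V0.
  by rewrite -degG /max_degree big_pred0 // => x; have := fintype0 x V0.
have [col [leC pC]] := greedy_coloring leD.
have [h [h_inj h_lt h_col]] := rank_by_color col.
rewrite cardV in h_lt.
apply: leq_trans (min_ordered_ramsey_le G (pullback_ordering h_inj)) _.
(* By minimality it suffices that the bound itself satisfies [arrows]. *)
rewrite /ordered_ramsey; case: ex_minnP => N0 _; apply.
set N := _ * _; apply/forallP=> c.
pose r : rel 'I_N := fun x y => c [set x; y].
have r_sym : symmetric r by move=> x y; rewrite /r setUC.
have copy b f : monotone_copy G h (fun x y => r x y == b) f ->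
    [exists b : bool, exists f : {ffun V -> 'I_N},
      ordered_embedding (OGraph G (pullback_ordering h_inj)) (color_class c b) f].
  case=> f_lt f_b; apply/existsP; exists b; apply/existsP; exists (finfun f).
  have f_inj : injective f.
    move=> u v e; apply: h_inj.
    by case: (ltngtP (h u) (h v)) => // /f_lt; rewrite e ltnn.
  apply/and3P; split.
  - by apply/injectiveP=> u v; rewrite !ffunE => /f_inj.
  - apply/forallP=> u; apply/forallP=> v; apply/implyP=> /= Guv.
    rewrite !ffunE /color_adj (inj_eq f_inj) f_b // andbT.
    by apply: contraTneq Guv => ->; rewrite adj_irr.
  - apply/forallP=> u; apply/forallP=> v; apply/implyP.
    by rewrite natural_orderingE /prec /= !ffunE; apply: f_lt.
have [v||[f [f_lt f_r]]|[f [f_lt f_r]]] :=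
    @monotone_copy_or_complement N n Delta r V G h r_sym h_inj h_lt leD n_gt0 k col _ pC h_col.
- by apply: leq_ltn_trans (leC v) _; apply: up_logP.
- rewrite /N addn1 (expnSr n) [X in _ <= X]mulnA leq_mul2r; apply/orP; right.
  rewrite expnM -expnMn mulnAC (mulnA (2 ^ k)) (expnMn _ n) expnS.
  by rewrite (mulnCA n 2) (mulnCA n Delta.+1) !mulnA (mulnAC _ n).
- by apply: (copy true f); split=> // u v /f_r /eqP.
- by apply: (copy false f); split=> // u v /f_r /negbTE->.
Qed.
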